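(* Let $n\ge1$, let $\nu>0$, let $\Gamma$ be a full-rank lattice in $\mathbb{C}^n$ and let $\chi:\Gamma\to U(1)$ be a map. Let $\mathcal{F}^\nu_{\Gamma,\chi}$ be the complex vector space of $\mathcal{C}^\infty$ functions $f:\mathbb{C}^n\to\mathbb{C}$ satisfying $f(z+\gamma)=\chi(\gamma)e^{i\nu\omega(z,\gamma)}f(z)$ for all $z\in\mathbb{C}^n$ and $\gamma\in\Gamma$. Then $\mathcal{F}^\nu_{\Gamma,\chi}$ is a nonzero space if and only if $$\chi(\gamma_1+\gamma_2)=\chi(\gamma_1)\chi(\gamma_2)e^{i\nu\omega(\gamma_1,\gamma_2)}\qquad\text{for every }\gamma_1,\gamma_2\in\Gamma .$$ In this case $\mathcal{F}^\nu_{\Gamma,\chi}$ is an infinite-dimensional complex vector space.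
   Context: $\mathbb{C}^n$ carries the Hermitian form $\langle z,w\rangle=z_1\bar w_1+\cdots+z_n\bar w_n$, and $\omega(z,w)=\mathrm{Im}\langle z,w\rangle$. A full-rank lattice $\Gamma$ is a discrete subgroup of rank $2n$ of $(\mathbb{C}^n,+)$. $U(1)=\{\lambda\in\mathbb{C}:|\lambda|=1\}$. *)

(* Defs.v *)
From HB Require Import structures.
From mathcomp Require Import all_boot all_order all_algebra.
From mathcomp Require Import all_classical all_reals all_analysis.
From mathcomp Require Import complex.

Set Implicit Arguments.
Unset Strict Implicit.
Unset Printing Implicit Defensive.

Import Order.TTheory GRing.Theory Num.Theory.
Import numFieldNormedType.Exports.

Local Open Scope classical_set_scope.
Local Open Scope complex_scope.
Local Open Scope ring_scope.

Definition herm (R : realType) (n : nat) (z w : 'rV[R[i]]_n) : R[i] :=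
  \sum_(j < n) z 0 j * (w 0 j)^*.

Definition omega (R : realType) (n : nat) (z w : 'rV[R[i]]_n) : R :=
  complex.Im (herm z w).

(* e^{i t} for real t, by Euler's formula: the library exponential is real *)
Definition expi (R : realType) (t : R) : R[i] := cos t +i* sin t.

Definition int_independent (V : zmodType) (s : nat) (b : 'I_s -> V) : Prop :=
  forall m : 'I_s -> int, \sum_(i < s) b i *~ m i = 0 -> forall i, m i = 0.

(* rank of an abelian group: the largest size of a Z-independent family *)
Definition has_rank (V : zmodType) (G : set V) (r : nat) : Prop :=
  (exists b : 'I_r -> V, (forall i, G (b i)) /\ int_independent b) /\
  (forall (s : nat) (b : 'I_s -> V),
     (forall i, G (b i)) -> int_independent b -> (s <= r)%N).

Definition full_rank_lattice (R : realType) (n : nat) (G : set 'rV[R[i]]_n)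
  : Prop :=
  (* ^o selects the norm topology of R[i] *)
  [/\ zmod_closed [in G], G `<=` isolated (G : set 'rV[R[i]^o]_n)
    & has_rank G (2 * n)].

Fixpoint is_Ck (R : realType) (m k : nat) (g : 'rV[R]_m -> R) : Prop :=
  continuous g /\
  if k is k'.+1 then
    forall i : 'I_m, (forall x, derivable g x (delta_mx 0 i)) /\
                     is_Ck k' (fun x => 'D_(delta_mx 0 i) g x)
  else True.

Definition is_smooth (R : realType) (m : nat) (g : 'rV[R]_m -> R) : Prop :=
  forall k, is_Ck k g.

Definition complex_coords (R : realType) (n : nat) (x : 'rV[R]_(n + n))
  : 'rV[R[i]]_n :=
  \row_j (x 0 (lshift n j) +i* x 0 (rshift n j)).

(* smoothness is over R, through C^n = R^{2n} and C = R^2: the functions below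
   are not holomorphic in general *)
Definition is_smoothC (R : realType) (n : nat) (f : 'rV[R[i]]_n -> R[i])
  : Prop :=
  is_smooth (fun x => complex.Re (f (complex_coords x))) /\
  is_smooth (fun x => complex.Im (f (complex_coords x))).

(* Only the values of chi on G matter. *)
Definition quasi_periodic (R : realType) (n : nat) (nu : R)
  (G : set 'rV[R[i]]_n) (chi : 'rV[R[i]]_n -> R[i])
  : set ('rV[R[i]]_n -> R[i]) :=
  [set f | is_smoothC f /\
     forall z g, G g -> f (z + g) = chi g * expi (nu * omega z g) * f z].

(* This is the dimension of F only when F is a linear subspace, see
   quasi_periodic_submod. *)
Definition finite_dimensional (K : fieldType) (V : lmodType K) (F : set V)
  : Prop :=
  exists (m : nat) (b : 'I_m -> V), (forall i, F (b i)) /\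
    forall f, F f -> exists c : 'I_m -> K, f = \sum_(i < m) c i *: b i.

Definition infinite_dimensional (K : fieldType) (V : lmodType K) (F : set V)
  : Prop := ~ finite_dimensional F.

Lemma is_Ck_lin (R : realType) (m k : nat) (a b : R) (f g : 'rV[R]_m -> R) :
  is_Ck k f -> is_Ck k g -> is_Ck k (fun x => a * f x + b * g x).
Proof.
have lin_cts (u v : 'rV[R]_m -> R) : continuous u -> continuous v ->
    continuous (fun x => a * u x + b * v x).
  move=> cu cv x.
  have cu' := cvgZl_tmp (k:=a) (cu x); have cv' := cvgZl_tmp (k:=b) (cv x).
  exact: (cvgD (cu' _) (cv' _)).
elim: k f g => [|k IH] f g /= [cf df] [cg dg]; split; [exact: lin_cts|by []|
  exact: lin_cts|].
move=> i; have [dfi cfi] := df i; have [dgi cgi] := dg i.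
have E x : is_derive x (delta_mx 0 i) (fun x => a * f x + b * g x)
    (a * 'D_(delta_mx 0 i) f x + b * 'D_(delta_mx 0 i) g x).
  have Df : is_derive x (delta_mx 0 i) f ('D_(delta_mx 0 i) f x).
    by apply: DeriveDef => //; exact: dfi.
  have Dg : is_derive x (delta_mx 0 i) g ('D_(delta_mx 0 i) g x).
    by apply: DeriveDef => //; exact: dgi.
  exact: (is_deriveD (is_deriveZ a Df) (is_deriveZ b Dg)).
split=> [x|]; first by have [] := E x.
rewrite (_ : (fun x => _) = (fun x =>
  a * 'D_(delta_mx 0 i) f x + b * 'D_(delta_mx 0 i) g x)); first exact: IH.
by apply/funext => x; have [] := E x.
Qed.

Lemma is_smooth0 (R : realType) (m : nat) : is_smooth (fun _ : 'rV[R]_m => 0 : R).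
Proof.
have cts0 : continuous (fun _ : 'rV[R]_m => 0 : R)
  by exact: cst_continuous.
elim=> [|k IH] /=; split=> //.
have E x i : is_derive x (delta_mx 0 i) (fun _ : 'rV[R]_m => 0 : R) 0.
  exact: is_derive_cst.
move=> i; split=> [x|]; first by have [] := E x i.
rewrite (_ : (fun x => _) = fun _ => 0)//.
by apply/funext => x; have [] := E x i.
Qed.

Lemma quasi_periodic_submod (R : realType) (n : nat) (nu : R)
    (G : set 'rV[R[i]]_n) (chi : 'rV[R[i]]_n -> R[i]) :
  submod_closed [in quasi_periodic nu G chi].
Proof.
split=> [|a f g]; rewrite !inE.
  split=> [|z h _]; last by rewrite mulr0.
  by split; exact: is_smooth0.
move=> [[f1 f2] fG] [[g1 g2] gG]; split; last first.
  move=> z h Gh; rewrite !fctE fG// gG// mulrDr; congr (_ + _).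
  by rewrite /GRing.scale/= mulrCA.
split=> k.
- have := is_Ck_lin 1 1 (is_Ck_lin (complex.Re a) (- complex.Im a) (f1 k) (f2 k)) (g1 k).
  congr is_Ck; apply/funext => x; rewrite !fctE.
  by case: a (f _) (g _) => [a1 a2] [b1 b2] [c1 c2] /=; rewrite !mul1r mulNr.
- have := is_Ck_lin 1 1 (is_Ck_lin (complex.Re a) (complex.Im a) (f2 k) (f1 k)) (g2 k).
  congr is_Ck; apply/funext => x; rewrite !fctE.
  by case: a (f _) (g _) => [a1 a2] [b1 b2] [c1 c2] /=; rewrite !mul1r.
Qed.

(* Main.v *)
Require Import Defs.
From mathcomp Require Import all_boot all_order all_algebra.
From mathcomp Require Import all_classical all_reals all_analysis.
From mathcomp Require Import complex ring lra.
Import Order.TTheory GRing.Theory Num.Theory.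
Import numFieldNormedType.Exports.
Local Open Scope classical_set_scope.
Local Open Scope complex_scope.
Local Open Scope ring_scope.

(** If f is quasi-periodic and f(z) <> 0, computing f(z + g1 + g2) in two ways
    and dividing by f(z) gives the relation for chi
    ([quasi_periodic_cocycle]).

    Conversely, suppose the relation holds. A smooth function phi with small
    support is made quasi-periodic by its Poincare series: the sum over the
    lattice points g of chi(g)^-1 exp(-i nu omega(z, g)) phi(z + g). If the
    support is small compared with the separation of the lattice, the supports
    of the terms are disjoint, so that no convergence question arises and near
    each point the sum is a single term ([poincareE], [poincare_smooth]); the
    relation for chi makes it quasi-periodic ([poincare_quasi_periodic]). With
    bumps around m points that are close together in one fundamental cell this
    gives m quasi-periodic functions, each nonzero at its own point and zero at
    the others ([quasi_periodic_interpolation]). Hence the space is nonzero, and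
    no finite family can span it, since evaluation at m + 1 points has rank
    m + 1 ([infinite_dimensional_interpolation]).

    The bumps are built from exp(-1/t). Smoothness means that the iterated
    partial derivatives exist and are continuous; it is obtained from a class of
    explicit functions that is stable under partial derivatives
    ([locally_elementary_smooth]). *)

(** * The flat functions t^(-k) exp(-1/t) *)

(** The factors [t^-1 ^+ k] make the family stable under differentiation: the
    derivative of a member is a linear combination of two later members, so
    that all the derivatives of exp(-1/t) are handled at once. *)
Definition flat {R : realType} (k : nat) (t : R) : R :=
  if 0 < t then t^-1 ^+ k * expR (- t^-1) else 0.

Lemma flat_pos {R : realType} k (t : R) : 0 < t -> flat k t = t^-1 ^+ k * expR (- t^-1).
Proof. by rewrite /flat => ->. Qed.

Lemma flat_neg {R : realType} k (t : R) : t <= 0 -> flat k t = 0.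
Proof. by rewrite /flat => /le_gtF ->. Qed.

(** This exhibits [flat k.+1] as the difference quotient of [flat k] at 0. *)
Lemma flat_recr {R : realType} k (t : R) : flat k t = flat k.+1 t * t.
Proof.
rewrite /flat; case: ifPn => [t0|]; last by rewrite mul0r.
by rewrite exprSr -!mulrA [X in _ = _ * X]mulrC -!mulrA mulfV ?gt_eqF// mulr1.
Qed.

(** Exponential growth beats the power: 1/t is substituted in
    x^(k+1) / (k+1)! <= exp x, and one factor 1/t is left over as [t]. *)
Lemma flat_le {R : realType} k (t : R) : `|flat k t| <= k.+1`!%:R * `|t|.
Proof.
rewrite /flat; case: ifPn => [t0|]; last by rewrite normr0 mulr_ge0.
have e0 := expR_gt0 t^-1.
have V0 : 0 < t^-1 by rewrite invr_gt0.
rewrite ger0_norm ?mulr_ge0 ?exprn_ge0 ?expR_ge0 ?(ltW V0)//.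
rewrite gtr0_norm// expRN ler_pdivrMr//.
have F0 : (0 : R) < k.+1`!%:R by rewrite ltr0n fact_gt0.
have : t^-1 ^+ k.+1 / k.+1`!%:R <= expR t^-1.
  by apply: le_trans (expR_ge1Dxn k (ltW V0)); rewrite lerDr.
rewrite ler_pdivrMr// => /(ler_wpM2r (ltW t0)).
rewrite exprSr -mulrA mulVf ?gt_eqF// mulr1 => /le_trans; apply.
by rewrite [expR _ * _]mulrC mulrAC.
Qed.

Lemma flat_continuous0 {R : realType} k : {for 0, continuous (@flat R k)}.
Proof.
rewrite /prop_for /continuous_at flat_neg//.
apply/cvgr0Pnorm_lt => e e0.
have F0 : (0 : R) < k.+1`!%:R by rewrite ltr0n fact_gt0.
apply/nbhs_ballP; exists (e / k.+1`!%:R) => /=; first by rewrite divr_gt0.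
move=> t; rewrite /ball/= sub0r normrN => te.
by apply: le_lt_trans (flat_le _ _) _; rewrite mulrC -ltr_pdivlMr.
Qed.

(** For positive [t] this is the product rule, and for negative [t] both sides
    vanish. At 0 the slope of [flat k] is the
    function [flat k.+1], which is continuous there with value 0. *)
Lemma is_derive_flat {R : realType} k (t : R) :
  is_derive t 1 (flat k) (flat k.+2 t - k%:R * flat k.+1 t).
Proof.
have [t0|t0|<-] := ltgtP 0 t; last first.
- rewrite !flat_neg// mulr0 subr0.
  apply/is_derive1_caratheodory; exists (flat k.+1); split.
  + by move=> z; rewrite (@flat_neg _ _ 0)// !subr0 flat_recr.
  + exact: flat_continuous0.
  + by rewrite flat_neg.
- rewrite !flat_neg 1?ltW// mulr0 subr0.
  apply: (@near_eq_is_derive _ _ _ (cst 0)) => //.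
    near=> s; rewrite flat_neg// ltW//; near: s; exact: lt_nbhsl.
- rewrite !flat_pos//.
  have tn0 : t != 0 by rewrite gt_eqF.
  apply: (@near_eq_is_derive _ _ _ (fun s : R => s^-1 ^+ k * expR (- s^-1))) => //.
    near=> s; rewrite flat_pos//; near: s; exact: lt_nbhsr.
  have DV : is_derive t 1 (fun s : R => s^-1) (- t ^- 2 *: 1).
    exact: (is_deriveV (f := id)).
  have DX := is_deriveX k DV.
  have DN := is_deriveN DV.
  have DE := @is_derive1_comp _ expR _ _ _ _ (is_derive_expR _) DN.
  have -> : (fun s : R => s^-1 ^+ k * expR (- s^-1)) =
      (fun s : R => s^-1) ^+ k * (expR \o - (fun s : R => s^-1)).
    by apply/funext => s; rewrite !fctE.
  apply: (is_derive_eq (is_deriveM DX DE)).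
  rewrite !scaler1 /GRing.scale/= !fctE.
  rewrite opprK -!exprVn.
  case: k {DX} => [|k].
    rewrite /=; ring.
  rewrite /= !exprS; ring.
Unshelve. all: by end_near. Qed.

(** * A class of functions closed under partial derivatives *)

(** Restricting to a line turns directional derivatives into one-variable
    derivatives, for which the chain rule is available. *)
Lemma is_derive_line {R : realType} {V : normedModType R} {f : V -> R} {x v : V} {d : R} :
  is_derive x v f d <-> is_derive (0 : R) 1 (fun t : R => f (t *: v + x)) d.
Proof.
have E : (fun h : R => h^-1 *: ((f \o shift x) (h *: v) - f x)) =
    (fun h : R => h^-1 *:
      (((fun t : R => f (t *: v + x)) \o shift 0) (h *: 1) - f (0 *: v + x))).
  by apply/funext => h /=; rewrite addr0 scale0r add0r [h *: 1]mulr1.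
split=> -[D1 D2]; split; move: D1 D2; rewrite /derivable /derive.
- by rewrite E.
- by rewrite E.
- by rewrite -E.
- by rewrite -E.
Qed.

Lemma is_derive_comp1 {R : realType} {V : normedModType R} {h : R -> R} {f : V -> R}
    {x v : V} {a b : R} :
  is_derive (f x) 1 h a -> is_derive x v f b -> is_derive x v (h \o f) (a * b).
Proof.
move=> Dh /is_derive_line Df; apply/is_derive_line.
apply: (@is_derive1_comp _ h) => //.
by rewrite scale0r add0r.
Qed.

(** The smoothness predicate asks for continuity of all iterated partial
    derivatives. This class contains the formulas needed below, consists of
    continuous functions and is closed under partial derivatives; smoothness of
    its members then follows without computing any iterated derivative. *)
Inductive elementary {R : realType} {m : nat} : ('rV[R]_m -> R) -> Prop :=
| elementary_cst c : elementary (cst c)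
| elementary_coord j : elementary (fun x => x 0 j)
| elementary_add f g : elementary f -> elementary g -> elementary (f + g)
| elementary_mul f g : elementary f -> elementary g -> elementary (f * g)
| elementary_sin f : elementary f -> elementary (sin \o f)
| elementary_cos f : elementary f -> elementary (cos \o f)
| elementary_flat k f : elementary f -> elementary (flat k \o f).

Lemma elementary_ext {R : realType} {m : nat} {f g : 'rV[R]_m -> R} :
  elementary f -> f =1 g -> elementary g.
Proof. by move=> ef /funext <-. Qed.

Lemma elementary_opp {R : realType} {m : nat} (f : 'rV[R]_m -> R) :
  elementary f -> elementary (fun x => - f x).
Proof.
move=> ef; apply: elementary_ext (elementary_mul _ _ (elementary_cst (-1)) ef) _.
by move=> x; rewrite !fctE mulN1r.
Qed.

Lemma elementary_sum {R : realType} {m n : nat} (F : 'I_n -> 'rV[R]_m -> R) :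
  (forall j, elementary (F j)) -> elementary (fun x => \sum_(j < n) F j x).
Proof.
move=> eF; rewrite -fct_sumE.
by apply: big_ind => //; [exact: elementary_cst|exact: elementary_add].
Qed.

Lemma elementary_continuous {R : realType} {m : nat} {f : 'rV[R]_m -> R} :
  elementary f -> continuous f.
Proof.
elim=> {f} [c|j|f g _ cf _ cg|f g _ cf _ cg|f _ cf|f _ cf|k f _ cf] x.
- exact: cst_continuous.
- exact: coord_continuous.
- exact: (continuousD (cf x) (cg x)).
- exact: (continuousM (cf x) (cg x)).
- by apply: continuous_comp; [exact: cf|exact: continuous_sin].
- by apply: continuous_comp; [exact: cf|exact: continuous_cos].
- apply: continuous_comp; first exact: cf.
  apply/differentiable_continuous/derivable1_diffP.
  by have [] := is_derive_flat k (f x).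
Qed.

Lemma elementary_derive {R : realType} {m : nat} {f : 'rV[R]_m -> R} v :
  elementary f ->
  exists2 g, elementary g & forall x, is_derive x v f (g x).
Proof.
elim=> {f} [c|j|f g ef [f' ef' Df] eg [g' eg' Dg]|f g ef [f' ef' Df] eg [g' eg' Dg]
  |f ef [f' ef' Df]|f ef [f' ef' Df]|k f ef [f' ef' Df]].
- by exists (cst 0); [exact: elementary_cst|move=> x; exact: is_derive_cst].
- exists (cst (v 0 j)); first exact: elementary_cst.
  move=> x; apply/is_derive_line.
  rewrite (_ : (fun _ => _) = id * cst (v 0 j) + cst (x 0 j)); last first.
    by apply/funext => t; rewrite !mxE.
  have D1 := is_deriveM (is_derive_id (0 : R) (1 : R)) (is_derive_cst (v 0 j) (0 : R) (1 : R)).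
  apply: (is_derive_eq (is_deriveD D1 (is_derive_cst (x 0 j) (0 : R) (1 : R)))).
  by rewrite scaler0 add0r addr0 [_ *: 1]mulr1.
- exists (f' + g'); first exact: elementary_add.
  by move=> x; exact: is_deriveD.
- exists (f * g' + g * f').
    by apply: elementary_add; apply: elementary_mul.
  by move=> x; exact: is_deriveM.
- exists ((cos \o f) * f').
    by apply: elementary_mul => //; exact: elementary_cos.
  by move=> x; exact: is_derive_comp1.
- exists (cst (-1) * ((sin \o f) * f')).
    apply: elementary_mul; first exact: elementary_cst.
    by apply: elementary_mul => //; exact: elementary_sin.
  move=> x; have D := is_derive_comp1 (is_derive_cos (f x)) (Df x).
  apply: (is_derive_eq D).
  by rewrite !fctE /=; ring.
- exists (((flat k.+2 \o f) + cst (- k%:R) * (flat k.+1 \o f)) * f').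
    apply: elementary_mul => //; apply: elementary_add.
      exact: elementary_flat.
    by apply: elementary_mul; [exact: elementary_cst|exact: elementary_flat].
  move=> x; have D := is_derive_comp1 (is_derive_flat k (f x)) (Df x).
  apply: (is_derive_eq D).
  by rewrite !fctE /=; ring.
Qed.

(** Coinciding locally with an elementary function is inherited by partial
    derivatives, hence the induction on the order of differentiability. This
    local form is what functions defined by a choice of lattice point need. *)
Lemma locally_elementary_smooth {R : realType} {m : nat} (f : 'rV[R]_m -> R) :
  (forall x : 'rV[R]_m, exists2 g, elementary g & \forall y \near x, g y = f y) ->
  is_smooth f.
Proof.
have cts h : (forall x : 'rV[R]_m,
    exists2 g, elementary g & \forall y \near x, g y = h y) -> continuous h.
  move=> Hh x; have [g eg gh] := Hh x.
  rewrite /continuous_at -(nbhs_singleton gh).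
  apply: cvg_trans (elementary_continuous eg x).
  by apply: near_eq_cvg; [exact: nbhs_filter|exact: gh].
move=> Hf k; elim: k f Hf => [|k IH] f Hf /=; first by split=> //; exact: cts.
split=> [|i]; first exact: cts.
have D (x : 'rV[R]_m) : exists2 g, elementary g &
    \forall y \near x, is_derive y (delta_mx 0 i) f (g y).
  have [g eg gf] := Hf x.
  have [g' eg' Dg] := elementary_derive (delta_mx 0 i) eg.
  exists g' => //.
  have := near_join gf; apply: filterS => y gfy.
  exact: near_eq_is_derive gfy (Dg y).
split=> [x|].
  have [g' _ /nbhs_singleton] := D x.
  by move=> [].
apply: IH => x; have [g' eg' Dg] := D x.
exists g' => //; apply: filterS Dg => y [_ <-] //.
Qed.

(** * The multiplier exp(i nu omega) *)

Lemma expiD {R : realType} (s t : R) : expi (s + t) = expi s * expi t.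
Proof.
rewrite /expi sinD cosD; apply/eqP; rewrite eq_complex /=.
by apply/andP; split; apply/eqP; ring.
Qed.

Lemma expi0 {R : realType} : expi (0 : R) = 1.
Proof. by rewrite /expi sin0 cos0. Qed.

Lemma expi_neq0 {R : realType} (t : R) : expi t != 0.
Proof.
apply/eqP => e0; have := expiD t (- t).
by rewrite subrr expi0 e0 mul0r => /eqP; rewrite oner_eq0.
Qed.

Lemma expiN {R : realType} (t : R) : expi (- t) = (expi t)^-1.
Proof.
by apply: (mulfI (expi_neq0 t)); rewrite -expiD subrr expi0 mulfV ?expi_neq0.
Qed.

Lemma omegaE {R : realType} {n : nat} (z w : 'rV[R[i]]_n) :
  omega z w = \sum_(j < n) (complex.Im (z 0 j) * complex.Re (w 0 j)
                            - complex.Re (z 0 j) * complex.Im (w 0 j)).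
Proof.
rewrite /omega /herm (big_morph (@complex.Im R) (id1 := 0) (op1 := +%R))//.
  apply: eq_bigr => j _.
  by case: (z 0 j) (w 0 j) => [a b] [c d] /=; ring.
by move=> [a b] [c d].
Qed.

Lemma omegaDl {R : realType} {n : nat} (z z' w : 'rV[R[i]]_n) :
  omega (z + z') w = omega z w + omega z' w.
Proof.
rewrite !omegaE -big_split; apply: eq_bigr => j _; rewrite !mxE.
by case: (z 0 j) (z' 0 j) => [a b] [c d] /=; ring.
Qed.

Lemma omegaDr {R : realType} {n : nat} (z w w' : 'rV[R[i]]_n) :
  omega z (w + w') = omega z w + omega z w'.
Proof.
rewrite !omegaE -big_split; apply: eq_bigr => j _; rewrite !mxE.
by case: (w 0 j) (w' 0 j) => [a b] [c d] /=; ring.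
Qed.

(** * Discreteness and bumps in coordinates *)

Definition small {R : realType} {n : nat} (r : R) (z : 'rV[R[i]]_n) : Prop :=
  forall j, `|complex.Re (z 0 j)| < r /\ `|complex.Im (z 0 j)| < r.

Lemma smallB {R : realType} {n : nat} {r s : R} {z w : 'rV[R[i]]_n} :
  small r z -> small s w -> small (r + s) (z - w).
Proof.
move=> sz sw j; have [zr zi] := sz j; have [wr wi] := sw j.
rewrite !mxE; case: (z 0 j) (w 0 j) zr zi wr wi => [a b] [c d] /= zr zi wr wi.
by split; apply: le_lt_trans (ler_normB _ _) (ltrD _ _).
Qed.

Lemma smallW {R : realType} {n : nat} {r s : R} {z : 'rV[R[i]]_n} :
  r <= s -> small r z -> small s z.
Proof. by move=> rs sz j; have [zr zi] := sz j; split; exact: lt_le_trans rs. Qed.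

(** Isolation of 0 separates all points of [G], because their differences
    are again in [G]. The radius of the ball around 0 is a complex number
    [e1 +i* e2]; being positive, it is real. *)
Lemma discrete_separated {R : realType} {n : nat} (G : set 'rV[R[i]]_n) :
  zmod_closed [in G] -> G `<=` isolated (G : set 'rV[R[i]^o]_n) ->
  exists2 d : R, 0 < d & forall g, G g -> small d g -> g = 0.
Proof.
move=> [/set_mem G0 _] /(_ _ G0)[_ [V /nbhs_ballP[[e1 e2] /= e0 eV] VG]].
move: e0; rewrite ltcE /= => /andP[/eqP e20 e10].
(* If both parts of w are below e1 / 2, then |w|^2 < e1^2 / 2. *)
exists (e1 / 2); first by rewrite divr_gt0.
move=> g Gg sg; suff : (V `&` G) g by rewrite VG.
split=> //; apply: eV; split; first by rewrite ltcE /= e20 eqxx.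
move=> i j; rewrite (ord1 i) mxE /ball/= sub0r normrN.
have [gr gi] := sg j.
rewrite normc_def ltcE /= e20 eqxx /=.
rewrite -[ltRHS]ger0_norm ?ltW// -sqrtr_sqr ltr_sqrt ?exprn_gt0//.
move: gr gi; rewrite !ltr_norml => /andP[r1 r2] /andP[i1 i2].
nra.
Qed.

(** The argument of [flat] is a polynomial in the real coordinates, positive
    exactly inside the Euclidean ball of radius [r]. *)
Definition bump {R : realType} {n : nat} (r : R) (z : 'rV[R[i]]_n) : R :=
  flat 0 (r ^+ 2 - \sum_(j < n) (complex.Re (z 0 j) ^+ 2 + complex.Im (z 0 j) ^+ 2)).

Lemma bump_small {R : realType} {n : nat} (r : R) (z : 'rV[R[i]]_n) :
  0 < r -> bump r z != 0 -> small r z.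
Proof.
move=> r0; rewrite /bump.
set s := \sum_(_ < _) _; have [/flat_neg ->|] := leP (r ^+ 2 - s) 0; first by rewrite eqxx.
rewrite subr_gt0 => sr _ j.
have : complex.Re (z 0 j) ^+ 2 + complex.Im (z 0 j) ^+ 2 < r ^+ 2.
  apply: le_lt_trans sr; rewrite /s (bigD1 j)//= lerDl sumr_ge0// => k _.
  by rewrite addr_ge0 ?sqr_ge0.
move: (complex.Re _) (complex.Im _) => a b ab.
by split; rewrite -(@ltr_pXn2r _ 2) ?nnegrE ?(ltW r0)// real_normK ?num_real//;
  apply: le_lt_trans ab; rewrite ?lerDl ?lerDr sqr_ge0.
Qed.

Lemma bump0 {R : realType} {n : nat} (r : R) : 0 < r -> bump r (0 : 'rV[R[i]]_n) != 0.
Proof.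
move=> r0; rewrite /bump big1 => [|j _]; last by rewrite mxE expr0n addr0.
by rewrite subr0 flat_pos ?exprn_gt0// mul1r gt_eqF ?expR_gt0.
Qed.

(** * Necessity of the relation for chi *)

Definition cocycle {R : realType} {n : nat} (nu : R) (G : set 'rV[R[i]]_n)
    (chi : 'rV[R[i]]_n -> R[i]) : Prop :=
  forall g1 g2, G g1 -> G g2 ->
    chi (g1 + g2) = chi g1 * chi g2 * expi (nu * omega g1 g2).

Lemma zmod_closed_set {V : zmodType} {G : set V} : zmod_closed [in G] ->
  [/\ G 0, forall g h, G g -> G h -> G (g - h) & forall g h, G g -> G h -> G (g + h)].
Proof.
move=> [/set_mem G0 GB].
have GB' g h : G g -> G h -> G (g - h).
  by move=> Gg Gh; apply/set_mem/GB; rewrite inE.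
split=> // g h Gg Gh; rewrite -[h]opprK -[- h]sub0r.
by apply: (GB') => //; exact: GB'.
Qed.

(** Translating by [g1 + g2] at once or in two steps multiplies [f z] by
    chi(g1 + g2) exp(i nu (omega(z, g1) + omega(z, g2))), respectively by
    chi(g1) chi(g2) exp(i nu (omega(z, g1) + omega(z, g2) + omega(g1, g2))).
    At a point where [f z != 0] the two factors must agree. *)
Lemma quasi_periodic_cocycle {R : realType} {n : nat} (nu : R) (G : set 'rV[R[i]]_n)
    (chi : 'rV[R[i]]_n -> R[i]) f :
  zmod_closed [in G] -> quasi_periodic nu G chi f -> f <> 0 -> cocycle nu G chi.
Proof.
move=> /zmod_closed_set[_ _ GD] [_ qf] f0 g1 g2 Gg1 Gg2.
have [z fz] : exists z, f z != 0.
  apply: contra_notP f0 => /forallNP f0; apply/funext => z.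
  by apply/eqP; apply: contra_notT (f0 z).
have Gg : G (g1 + g2) by exact: GD.
have := qf z _ Gg; rewrite addrA qf// qf// omegaDl omegaDr !mulrDr !expiD.
move=> e; apply: (mulIf fz); apply: (mulIf (expi_neq0 (nu * omega z g1))).
apply: (mulIf (expi_neq0 (nu * omega z g2))).
transitivity (chi (g1 + g2) * (expi (nu * omega z g1) * expi (nu * omega z g2)) * f z).
  by ring.
by rewrite -e; ring.
Qed.

(** * Quasi-periodic extension of a bump *)

(** The Poincare series of [phi], that is the sum over the g in [G] of
    chi(g)^-1 exp(-i nu omega(z, g)) phi(z + g), in the case where the translates
    of the support of [phi] are disjoint: at most one term of the series is
    nonzero at [z], and [xget] selects it. When all terms vanish the default 0,
    which is a point of [G], selects a vanishing term. *)
Definition poincare {R : realType} {n : nat} (nu : R) (G : set 'rV[R[i]]_n)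
    (chi : 'rV[R[i]]_n -> R[i]) (phi : 'rV[R[i]]_n -> R) (z : 'rV[R[i]]_n) : R[i] :=
  let g := xget 0 [set g | G g /\ phi (z + g) != 0] in
  (chi g)^-1 * expi (- (nu * omega z g)) * (phi (z + g))%:C.

(** Any [g] that is the only candidate for a nonzero term may be used to
    compute the series, even if its own term vanishes. This allows one and the
    same [g] on a whole neighbourhood. *)
Lemma poincareE {R : realType} {n : nat} {nu : R} {G : set 'rV[R[i]]_n}
    {chi : 'rV[R[i]]_n -> R[i]} {phi : 'rV[R[i]]_n -> R} {z : 'rV[R[i]]_n} g :
  G 0 -> G g -> (forall g', G g' -> phi (z + g') != 0 -> g' = g) ->
  poincare nu G chi phi z =
  (chi g)^-1 * expi (- (nu * omega z g)) * (phi (z + g))%:C.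
Proof.
move=> G0 Gg Hg; rewrite /poincare.
case: xgetP => [k _ [Gk pk]|H]; first by rewrite (Hg k Gk pk).
have phi0 k : G k -> phi (z + k) = 0.
  by move=> Gk; apply/eqP; apply: contra_notT (H k).
by rewrite !phi0 // rmorph0 !mulr0.
Qed.

Definition disjoint_translates {R : realType} {n : nat} (G : set 'rV[R[i]]_n)
    (phi : 'rV[R[i]]_n -> R) : Prop :=
  forall z g g', G g -> G g' -> phi (z + g) != 0 -> phi (z + g') != 0 -> g = g'.

(** Translating [z] by [g] turns the term of index h at z + g into the term of
    index g + h at z; the cocycle relation says exactly that the coefficients
    of these two terms differ by the expected multiplier. *)
Lemma poincare_quasi_periodic {R : realType} {n : nat} (nu : R) (G : set 'rV[R[i]]_n)
    (chi : 'rV[R[i]]_n -> R[i]) (phi : 'rV[R[i]]_n -> R) :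
  zmod_closed [in G] -> (forall g, G g -> chi g != 0) -> cocycle nu G chi ->
  disjoint_translates G phi ->
  forall z g, G g ->
    poincare nu G chi phi (z + g) = chi g * expi (nu * omega z g) * poincare nu G chi phi z.
Proof.
move=> /zmod_closed_set[G0 GB GD] chi0 co sep z g Gg.
have [[h [Gh ph]]|none] := pselect (exists h, G h /\ phi (z + g + h) != 0).
  rewrite (poincareE h)// => [|k Gk pk]; last exact: (sep (z + g)).
  rewrite (poincareE (g + h))//; first last.
  - by move=> k Gk pk; apply: (sep z) => //; [exact: GD|rewrite addrA].
  - exact: GD.
  rewrite co// omegaDr omegaDl !mulrDr !opprD !expiD !expiN addrA.
  by field; rewrite !expi_neq0 !chi0.
have phi0 h : G h -> phi (z + g + h) = 0.
  move=> Gh; apply/eqP; apply: contra_notT none => ph; by exists h.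
rewrite (poincareE 0)// => [|k Gk]; last by rewrite phi0 ?eqxx.
rewrite (poincareE g)// => [|k Gk].
  by have := phi0 0 G0; rewrite addr0 => ->; rewrite rmorph0 !mulr0.
have -> : z + k = z + g + (k - g) by rewrite addrACA addrN addr0.
by rewrite phi0 ?eqxx //; exact: GB.
Qed.

(** * Smoothness of the extension *)

Lemma elementary_Re {R : realType} {n : nat} j :
  elementary (fun x : 'rV[R]_(n + n) => complex.Re (complex_coords x 0 j)).
Proof.
by apply: elementary_ext (elementary_coord (lshift n j)) _ => x; rewrite mxE.
Qed.

Lemma elementary_Im {R : realType} {n : nat} j :
  elementary (fun x : 'rV[R]_(n + n) => complex.Im (complex_coords x 0 j)).
Proof.
by apply: elementary_ext (elementary_coord (rshift n j)) _ => x; rewrite mxE.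
Qed.

Lemma elementary_omega {R : realType} {n : nat} (g : 'rV[R[i]]_n) :
  elementary (fun x => omega (complex_coords x) g).
Proof.
apply: (@elementary_ext _ _ (fun x => \sum_(j < n)
    (complex.Im (complex_coords x 0 j) * complex.Re (g 0 j)
     - complex.Re (complex_coords x 0 j) * complex.Im (g 0 j)))); last first.
  by move=> x; rewrite omegaE.
apply: elementary_sum => j; apply: elementary_add.
  exact: elementary_mul (elementary_Im j) (elementary_cst _).
exact: elementary_opp (elementary_mul _ _ (elementary_Re j) (elementary_cst _)).
Qed.

Lemma elementary_bump {R : realType} {n : nat} (r : R) (p : 'rV[R[i]]_n) :
  elementary (fun x => bump r (complex_coords x + p)).
Proof.
apply: elementary_flat; apply: elementary_add; first exact: elementary_cst.
apply: elementary_opp; apply: elementary_sum => j.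
have eRe : elementary (fun x => complex.Re ((complex_coords x + p) 0 j)).
  apply: elementary_ext (elementary_add _ _ (elementary_Re j)
    (elementary_cst (complex.Re (p 0 j)))) _ => x.
  by rewrite fctE !mxE; case: (p 0 j).
have eIm : elementary (fun x => complex.Im ((complex_coords x + p) 0 j)).
  apply: elementary_ext (elementary_add _ _ (elementary_Im j)
    (elementary_cst (complex.Im (p 0 j)))) _ => x.
  by rewrite fctE !mxE; case: (p 0 j).
by apply: elementary_add; exact: elementary_mul.
Qed.

Lemma elementary_poincare_term {R : realType} {n : nat} (nu : R) (c : R[i]) (g p : 'rV[R[i]]_n) r :
  let h x := c * expi (- (nu * omega (complex_coords x) g))
             * (bump r (complex_coords x + p))%:C in
  elementary (fun x => complex.Re (h x)) /\ elementary (fun x => complex.Im (h x)).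
Proof.
have et : elementary (fun x => - (nu * omega (complex_coords x) g)).
  exact: elementary_opp (elementary_mul _ _ (elementary_cst nu) (elementary_omega g)).
have ec := elementary_cos _ et; have es := elementary_sin _ et.
have eb := elementary_bump r p.
have cM (a : R) (f : 'rV[R]_(n + n) -> R) : elementary f -> elementary (cst a * f).
  exact: elementary_mul (elementary_cst a).
case: c => a b h; split.
- have E := elementary_mul _ _ (elementary_add _ _ (cM a _ ec) (cM (- b) _ es)) eb.
  apply: (elementary_ext E) => x.
  by rewrite !fctE /h /=; ring.
- have E := elementary_mul _ _ (elementary_add _ _ (cM a _ es) (cM b _ ec)) eb.
  apply: (elementary_ext E) => x.
  by rewrite !fctE /h /=; ring.
Qed.

Lemma near_complex_coords {R : realType} {n : nat} (r : R) (x : 'rV[R]_(n + n)) :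
  0 < r -> \forall y \near x, small r (complex_coords y - complex_coords x).
Proof.
move=> r0; apply/nbhs_ballP; exists r => //= y [_ xy] j.
by rewrite !mxE /= -!(distrC (x 0 _)); split; exact: xy.
Qed.

(** On a box of radius [r] only one lattice translate of the bump is visible:
    two lattice points whose terms are nonzero at two points of the box differ
    by a lattice vector of size less than 4 r. The extension is therefore a
    single term of the series on that box. *)
Lemma poincare_smooth {R : realType} {n : nat} (nu : R) (G : set 'rV[R[i]]_n)
    (chi : 'rV[R[i]]_n -> R[i]) (r : R) (p : 'rV[R[i]]_n) :
  G 0 -> (forall g h, G g -> G h -> G (g - h)) ->
  0 < r -> (forall g, G g -> small (4 * r) g -> g = 0) ->
  is_smoothC (poincare nu G chi (fun z => bump r (z - p))).
Proof.
move=> G0 GB r0 sepG.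
have local z0 : exists2 g, G g & forall z, small r (z - z0) ->
    forall g', G g' -> bump r (z + g' - p) != 0 -> g' = g.
  have [[z1 [g [s1 [Gg pg]]]]|none] := pselect (exists z1 g,
      small r (z1 - z0) /\ G g /\ bump r (z1 + g - p) != 0).
    exists g => // z sz g' Gg' pg'; apply/eqP; rewrite -subr_eq0; apply/eqP.
    apply: sepG; first exact: GB.
    have := smallB (smallB (bump_small _ _ r0 pg') (bump_small _ _ r0 pg)) (smallB sz s1).
    have -> : z + g' - p - (z1 + g - p) - (z - z0 - (z1 - z0)) = g' - g.
      by apply/rowP => j; rewrite !mxE; ring.
    by apply: smallW; lra.
  by exists 0 => // z sz g Gg pg; case: none; exists z, g.
have P (x : 'rV[R]_(n + n)) : exists2 h : 'rV[R]_(n + n) -> R[i],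
    elementary (fun x => complex.Re (h x)) /\ elementary (fun x => complex.Im (h x)) &
    \forall y \near x,
      h y = poincare nu G chi (fun z => bump r (z - p)) (complex_coords y).
  have [g Gg Hg] := local (complex_coords x).
  have := elementary_poincare_term nu (chi g)^-1 g (g - p) r.
  set h := fun _ => _; exists h => //.
  apply: filterS (near_complex_coords r x r0) => y sy.
  by rewrite (poincareE (phi := fun z => bump r (z - p)) g G0 Gg (Hg _ sy)) -addrA.
split; apply: locally_elementary_smooth => x; have [h [eR eI] hx] := P x.
- by exists (fun x => complex.Re (h x)) => //; apply: filterS hx => y ->.
- by exists (fun x => complex.Im (h x)) => //; apply: filterS hx => y ->.
Qed.

(** The centres [p k] lie on the first real axis at mutual distances at least
    [r], so that the bump around [p k] vanishes at the other centres. The radius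
    makes all centres fit in a box so small, compared with the separation [d] of
    the lattice, that no lattice translate of [p j] comes near [p k] either. *)
Lemma quasi_periodic_interpolation {R : realType} {n : nat} (hn : (1 <= n)%N) (nu : R)
    (G : set 'rV[R[i]]_n) (chi : 'rV[R[i]]_n -> R[i]) (m : nat) :
  zmod_closed [in G] -> G `<=` isolated (G : set 'rV[R[i]^o]_n) ->
  (forall g, G g -> chi g != 0) -> cocycle nu G chi ->
  exists (p : 'I_m -> 'rV[R[i]]_n) (f : 'I_m -> 'rV[R[i]]_n -> R[i]),
    [/\ forall k, quasi_periodic nu G chi (f k),
        forall k, f k (p k) != 0 &
        forall k j, k != j -> f k (p j) = 0].
Proof.
move=> Gmod Giso chi0 co.
have [d d0 sepG] := discrete_separated _ Gmod Giso.
have [G0 GB GD] := zmod_closed_set Gmod.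
pose r := d / (4 * m.+1%:R).
have r0 : 0 < r by rewrite divr_gt0// mulr_gt0// ltr0n.
have rm : 4 * m.+1%:R * r = d by rewrite /r mulrC divfK// mulf_neq0// pnatr_eq0.
have r4 : 4 * r <= d.
  rewrite -rm -[4 * _ * r]mulrA ler_wpM2l// ler_peMl ?(ltW r0)// ler1n//.
pose j0 := Ordinal hn.
pose p (k : 'I_m) : 'rV[R[i]]_n := \row_j (if j == j0 then (k%:R * r)%:C else 0).
pose f (k : 'I_m) := poincare nu G chi (fun z => bump r (z - p k)).
have sep4 g : G g -> small (4 * r) g -> g = 0.
  by move=> Gg sg; apply: sepG => //; exact: smallW sg.
have sep k : disjoint_translates G (fun z => bump r (z - p k)).
  move=> z g g' Gg Gg' pg pg'; apply/eqP; rewrite -subr_eq0; apply/eqP.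
  apply: sep4; first exact: GB.
  have := smallB (bump_small _ _ r0 pg) (bump_small _ _ r0 pg').
  have -> : z + g - p k - (z + g' - p k) = g - g'.
    by apply/rowP => j; rewrite !mxE; ring.
  by apply: smallW; lra.
have pE (k : 'I_m) j : p k 0 j = (if j == j0 then k%:R * r else 0)%:C.
  by rewrite mxE; case: ifP.
exists p, f; split=> [k|k|k j kj].
- split; first exact: poincare_smooth.
  by move=> z g Gg; exact: poincare_quasi_periodic.
- have bk : bump r (p k + 0 - p k) != 0 by rewrite addr0 subrr bump0.
  rewrite /f (poincareE 0)//; last by move=> g Gg pg; exact: (sep k (p k)).
  rewrite !mulf_neq0 ?invr_eq0 ?chi0 ?expi_neq0//.
  by rewrite eq_complex /= eqxx andbT.
- have none g : G g -> bump r (p j + g - p k) = 0.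
    move=> Gg; apply/eqP; apply: contraT => pg.
    have sg := bump_small _ _ r0 pg.
    (* The lattice vector [g] is the difference of two small vectors. *)
    have g0 : g = 0.
      have sp : small (m.+1%:R * r) (p j - p k).
        move=> i; rewrite mxE [(- p k) 0 i]mxE !pE /= subr0 normr0.
        split; last by rewrite mulr_gt0// ltr0n.
        case: ifP => _; last by rewrite subr0 normr0 mulr_gt0// ltr0n.
        rewrite -mulrBl normrM (gtr0_norm r0) ltr_pM2r// ltr_norml.
        have [jm km] := (ltn_ord j, ltn_ord k).
        have : (j%:R : R) < m.+1%:R by rewrite ltr_nat ltnS ltnW.
        have : (k%:R : R) < m.+1%:R by rewrite ltr_nat ltnS ltnW.
        have : (0 : R) <= k%:R by [].
        have : (0 : R) <= j%:R by [].
        by move=> *; apply/andP; split; lra.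
      apply: sepG => //; have := smallB sg sp.
      have -> : p j + g - p k - (p j - p k) = g.
        by move: (p j) (p k) => a b; apply/rowP => i; rewrite !mxE; ring.
      apply: smallW; rewrite -rm.
      have : (1 : R) <= m.+1%:R by rewrite ler1n.
      by move=> m1; nra.
    (* Now [p j - p k] would be smaller than the spacing of the centres. *)
    have [+ _] := sg j0; rewrite g0 addr0 mxE [(- p k) 0 _]mxE !pE eqxx /=.
    rewrite -mulrBl normrM (gtr0_norm r0) -[ltRHS]mul1r ltr_pM2r// ltr_norml => /andP[].
    move: kj; rewrite neq_ltn => /orP[] kj.
      have : (k%:R + 1 : R) <= j%:R by rewrite natr1 ler_nat.
      by move=> *; exfalso; lra.
    have : (j%:R + 1 : R) <= k%:R by rewrite natr1 ler_nat.
    by move=> *; exfalso; lra.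
  rewrite /f (poincareE 0)// => [|g Gg]; first by rewrite none// rmorph0 mulr0.
  by rewrite none ?eqxx.
Qed.

(** * Dimension *)

(** If m functions spanned [F], the evaluation matrix of m + 1 functions at
    m + 1 points would factor through dimension m; but that matrix is diagonal
    and invertible. *)
Lemma infinite_dimensional_interpolation {K : fieldType} {T : Type} (F : set (T -> K^o)) :
  (forall m, exists (p : 'I_m -> T) (f : 'I_m -> T -> K^o),
    [/\ forall k, F (f k), forall k, f k (p k) != 0 &
        forall k j, k != j -> f k (p j) = 0]) ->
  infinite_dimensional F.
Proof.
move=> interp [m [b [_ span]]].
have [p [f [Ff fne f0]]] := interp m.+1.
have /boolp.choice[c fE] : forall k, exists ck : 'I_m -> K, f k = \sum_(i < m) ck i *: b i.
  by move=> k; exact: span.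
pose A : 'M[K]_(m.+1, m) := \matrix_(k, i) c k i.
pose B : 'M[K]_(m, m.+1) := \matrix_(i, j) (b i (p j) : K).
have AB : A *m B = diag_mx (\row_k f k (p k)).
  apply/matrixP => k j; rewrite !mxE.
  transitivity (f k (p j)).
    by rewrite fE fct_sumE; apply: eq_bigr => i _; rewrite !mxE.
  by have [<-|/f0 ->] := eqVneq k j; rewrite ?mulr1n ?mulr0n.
have : (\rank (A *m B) <= m)%N by exact: mulmx_max_rank.
rewrite AB mxrank_unit ?ltnn// unitmxE det_diag unitfE.
by apply/prodf_neq0 => k _; rewrite mxE; exact: fne.
Qed.

Theorem proposition3p1 (R : realType) (n : nat) (hn : (1 <= n)%N)
  (nu : R) (hnu : 0 < nu)
  (Gamma : set 'rV[R[i]]_n) (hGamma : full_rank_lattice Gamma)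
  (chi : 'rV[R[i]]_n -> R[i]) (hchi : forall g, Gamma g -> `|chi g| = 1) :
  ((exists f, quasi_periodic nu Gamma chi f /\ f <> 0) <->
   (forall g1 g2, Gamma g1 -> Gamma g2 ->
      chi (g1 + g2) = chi g1 * chi g2 * expi (nu * omega g1 g2))) /\
  ((exists f, quasi_periodic nu Gamma chi f /\ f <> 0) ->
   infinite_dimensional (quasi_periodic nu Gamma chi)).
Proof.
have [Gmod Giso _] := hGamma.
have chi0 g : Gamma g -> chi g != 0.
  by move=> Gg; rewrite -normr_eq0 hchi// oner_eq0.
have nonzero_cocycle : (exists f, quasi_periodic nu Gamma chi f /\ f <> 0) ->
    cocycle nu Gamma chi.
  by move=> [f [qf f0]]; exact: quasi_periodic_cocycle qf f0.
have interp co m := quasi_periodic_interpolation hn nu Gamma chi m Gmod Giso chi0 co.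
split; first split=> // co.
  (* One interpolating function is already a nonzero element. *)
  have [p [f [qf fne _]]] := interp co 1%N.
  exists (f ord0); split=> // f0; have := fne ord0.
  by rewrite f0 eqxx.
move=> /nonzero_cocycle co.
exact: (@infinite_dimensional_interpolation R[i]) (interp co).
Qed.
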